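(* There are precisely two $\mathbb{Z}$-PCFs for $\sqrt2$ of type $(1,2)$: $$\sqrt2=[1,\overline{2,2}]\qquad\text{and}\qquad\sqrt2=[2,\overline{-2,4}].$$
   Context: A $\mathbb{Z}$-PCF of type $(1,2)$ for $\sqrt2$ is a periodic continued fraction $[b_1,\overline{a_1,a_2}]$, with $b_1,a_1,a_2\in\mathbb{Z}$, whose value is $\sqrt2$ (the type need not be minimal, so $[1,\overline{2,2}]$ is allowed). Here the partial quotients $c_1,c_2,\ldots$ are $b_1,a_1,a_2,a_1,a_2,\ldots$; with $D(c)=\begin{bmatrix}c&1\\1&0\end{bmatrix}$, the $n$-th convergent is $M_{11}/M_{21}\in\mathbb{P}^1(\mathbb{C})$ with $M=D(c_1)\cdots D(c_n)$, and the value is the limit of the convergents in $\mathbb{P}^1(\mathbb{C})$, if it exists. *)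

(* Defs.v *)
From HB Require Import structures.
From mathcomp Require Import all_boot all_order all_algebra.
From mathcomp Require Import complex.
From mathcomp Require Import all_classical all_reals all_analysis.

Set Implicit Arguments.
Unset Strict Implicit.
Unset Printing Implicit Defensive.

Import Order.TTheory GRing.Theory Num.Theory.
Import numFieldNormedType.Exports.

Local Open Scope classical_set_scope.
Local Open Scope ring_scope.

(* The library puts the norm topology on the carrier of an abstract
   [numClosedFieldType], which is not found on [R[i]] itself. *)
Definition Cx (R : realType) : numClosedFieldType := R[i].

(* P^1(C) with its usual topology, as the Riemann sphere: [x : y] is
   [Some (x / y)] for y != 0, and [x : 0] is [None], the point at infinity. *)
Definition P1 (R : realType) : Type := one_point_compactification (Cx R).

HB.instance Definition _ (R : realType) := Topological.on (P1 R).

Definition P1_point (R : realType) (x y : Cx R) : P1 R :=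
  if y == 0 then None else Some (x / y).

Section ContinuedFraction.
Variable R : realType.

Definition cf_matrix (c : Cx R) : 'M[Cx R]_2 :=
  \matrix_(i, j) if (i == 0) && (j == 0) then c else (i != j)%:R.

(* Sequences of partial quotients are indexed from 0: [c i] is c_(i+1).  The
   product is taken from left to right.  The value at n = 0 (the identity
   matrix, giving the point at infinity) does not matter for limits.  Each
   [cf_matrix] has determinant -1, so the first column is never zero. *)
Definition cf_convergent (c : nat -> Cx R) (n : nat) : P1 R :=
  let M := \prod_(i < n) cf_matrix (c i) in P1_point (M 0 0) (M 1 0).

Definition cf_has_value (c : nat -> Cx R) (z : P1 R) : Prop :=
  cf_convergent c n @[n --> \oo] --> z.

(* Partial quotients of [b_1, ..., b_N, \overline{a_1, ..., a_k}], which is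
   of type (N, k) for N = size b and k = size a > 0. *)
Definition pcf_quotients (b a : seq int) (i : nat) : Cx R :=
  (if (i < size b)%N then b`_i else a`_((i - size b) %% size a))%:~R.

Definition Zpcf_for (b a : seq int) (z : Cx R) : Prop :=
  cf_has_value (pcf_quotients b a) (Some z).

End ContinuedFraction.

(* Main.v *)
(* Write M_n for the product of the first n matrices of [b, a1, a2, a1, a2, ...].
   Then M_(n+2) = Q M_n for n > 0, with Q = D(b) D(a1) D(a2) D(b)^-1 integral, so
   the limit of the convergents is a fixed point of the Moebius map of Q.  As
   sqrt 2 is irrational, this gives 2 b a1 = a1 a2 and a2 = a1 (2 - b^2).  If
   a1 = 0 every other convergent is infinite; otherwise a2 = 2 b and
   a1 (2 - b^2) = 2 b, which forces |b| <= 2 and leaves, up to a global sign,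
   the two expansions of the statement.  For both of them Q acts as
   x |-> (3 x + 4) / (2 x + 3), which contracts the half-line x >= 0 to
   sqrt 2; changing the sign of all partial quotients changes the sign of
   the value. *)

Require Import Defs.
From mathcomp Require Import all_boot all_order all_algebra.
From mathcomp Require Import complex.
From mathcomp Require Import all_classical all_reals all_analysis.
From mathcomp Require Import ring lra zify.

Set Implicit Arguments.
Unset Strict Implicit.
Unset Printing Implicit Defensive.

Import Order.TTheory GRing.Theory Num.Theory.
Import numFieldNormedType.Exports.

Local Open Scope classical_set_scope.
Local Open Scope ring_scope.

(** For nonzero [z] the 2-adic valuation of the left side would be even and that of the right side
    odd. *)
Lemma sqr_eq_double_sqr (w z : int) : w ^+ 2 = 2 * z ^+ 2 -> z = 0.
Proof.
move=> wz; apply/eqP; apply: contraTT isT => z0.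
have wz' : (`|w| ^ 2 = 2 * `|z| ^ 2)%N by rewrite -!abszX wz abszM.
have z_gt0 : (0 < `|z|)%N by rewrite absz_gt0.
have /(congr1 (logn 2)) := wz'.
rewrite lognM ?expn_gt0 ?z_gt0 // !lognX lognE /=.
by move=> /(congr1 odd); rewrite oddD !oddM.
Qed.

(** * Continuant recurrences and limits under Moebius maps *)

Lemma mul_cf_matrix (R : realType) (M : 'M[Cx R]_2) (a : Cx R) i :
  (M * cf_matrix a) i 0 = a * M i 0 + M i 1 /\ (M * cf_matrix a) i 1 = M i 0.
Proof.
have o0 : widen_ord (leqnSn 1) ord_max = 0 :> 'I_2 by apply/val_inj.
have o1 : ord_max = 1 :> 'I_2 by apply/val_inj.
rewrite -[M * _]/(M *m _) !mxE !big_ord_recr !big_ord0 /= o0 o1.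
rewrite /cf_matrix !mxE /= !mulr1 !add0r mulr0 addr0.
by split=> //; rewrite mulrC.
Qed.

(* [p] and [q] are the first column of M_n; the coefficients are the entries
   of Q. *)
Lemma periodic_continuant_step (K : comNzRingType) (c p q : nat -> K) :
    (forall n, c n.+3 = c n.+1) ->
    p 0%N = 1 -> p 1%N = c 0%N -> q 0%N = 0 -> q 1%N = 1 ->
    (forall n, p n.+2 = c n.+1 * p n.+1 + p n) ->
    (forall n, q n.+2 = c n.+1 * q n.+1 + q n) ->
  forall n,
    p n.+3 = (c 0%N * c 1%N + 1) * p n.+1 +
      (c 0%N * c 1%N * c 2%N + c 2%N - c 0%N ^+ 2 * c 1%N) * q n.+1 /\
    q n.+3 = c 1%N * p n.+1 + (c 1%N * c 2%N + 1 - c 0%N * c 1%N) * q n.+1.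
Proof.
move=> c_per p0 p1 q0 q1 pSS qSS n.
set A := _ + 1; set B := _ - _; set E := _ - _.
pose P n := p n.+3 = A * p n.+1 + B * q n.+1 /\
            q n.+3 = c 1%N * p n.+1 + E * q n.+1.
(* The recurrence has order two, so the induction carries two consecutive instances. *)
suff [] : P n /\ P n.+1 by [].
elim: n => [|n [[p3 q3] [p4 q4]]].
  rewrite /P !(pSS, qSS) p0 p1 q0 q1 c_per /A /B /E.
  by split; split; ring.
split=> //; split.
  rewrite pSS p4 [X in _ + X = _]p3 c_per (pSS n.+1) (qSS n.+1); ring.
rewrite qSS q4 [X in _ + X = _]q3 c_per (pSS n.+1) (qSS n.+1); ring.
Qed.

Lemma moebius_ratio (K : fieldType) (A B C E p q p' q' : K) :
    p' = A * p + B * q -> q' = C * p + E * q -> q != 0 -> q' != 0 ->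
  p' / q' * (C * (p / q) + E) = A * (p / q) + B.
Proof.
move=> p'E q'E q0 q'0.
have -> : C * (p / q) + E = q' / q by rewrite q'E; field.
by rewrite p'E; field; rewrite q0 q'0.
Qed.

(** With the denominator cleared, continuity of sums and products suffices, even where [C * l + E]
    might vanish. *)
Lemma moebius_limit_fixed (K : numFieldType) (A B C E l : K) (u : nat -> K) :
    u n @[n --> \oo] --> l ->
    (\forall n \near \oo, u n.+3 * (C * u n.+1 + E) = A * u n.+1 + B) ->
  l * (C * l + E) = A * l + B.
Proof.
move=> ul uE.
have shift k : u (n + k)%N @[n --> \oo] --> l by
  exact: cvg_comp (cvg_addnr k) ul.
have affine a b : a * u (n + 1)%N + b @[n --> \oo] --> a * l + b.
  by apply: cvgD; [apply: cvgM (shift 1%N); exact: cvg_cst | exact: cvg_cst].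
have lhs : u (n + 3)%N * (C * u (n + 1)%N + E) @[n --> \oo] --> l * (C * l + E).
  exact: cvgM (shift 3%N) (affine C E).
apply: (cvg_unique (@norm_hausdorff _ _) lhs).
apply: cvg_trans (affine A B); apply: near_eq_cvg.
by apply: filterS uE => n; rewrite addn1 addn3.
Qed.

(** * Convergents as ratios, and the fixed-point equation of a periodic expansion *)

Section FirstColumn.
Variables (R : realType) (c : nat -> Cx R).

Definition cf_num n := (\prod_(i < n) cf_matrix (c i)) 0 0.
Definition cf_den n := (\prod_(i < n) cf_matrix (c i)) 1 0.

Lemma cf_prod_recr n i :
  (\prod_(k < n.+2) cf_matrix (c k)) i 0 =
  c n.+1 * (\prod_(k < n.+1) cf_matrix (c k)) i 0 +
  (\prod_(k < n) cf_matrix (c k)) i 0.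
Proof.
rewrite big_ord_recr /=.
set M := \prod_(k < n.+1) _; rewrite (mul_cf_matrix M _ i).1; congr (_ + _).
by rewrite /M big_ord_recr (mul_cf_matrix _ _ i).2.
Qed.

Lemma cf_numSS n : cf_num n.+2 = c n.+1 * cf_num n.+1 + cf_num n.
Proof. exact: cf_prod_recr. Qed.

Lemma cf_denSS n : cf_den n.+2 = c n.+1 * cf_den n.+1 + cf_den n.
Proof. exact: cf_prod_recr. Qed.

Lemma cf_num0 : cf_num 0 = 1.
Proof. by rewrite /cf_num big_ord0 mxE. Qed.

Lemma cf_den0 : cf_den 0 = 0.
Proof. by rewrite /cf_den big_ord0 mxE. Qed.

Lemma cf_num1 : cf_num 1 = c 0.
Proof. by rewrite /cf_num big_ord_recl big_ord0 mulr1 mxE. Qed.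

Lemma cf_den1 : cf_den 1 = 1.
Proof. by rewrite /cf_den big_ord_recl big_ord0 mulr1 mxE. Qed.

(* Junk value: [cf_ratio n] is 0, not infinity, when [cf_den n = 0]. *)
Definition cf_ratio n := cf_num n / cf_den n.

Lemma cf_convergentE n :
  cf_convergent c n = if cf_den n == 0 then None else Some (cf_ratio n).
Proof. by []. Qed.

(** [Some] maps neighbourhoods of [l] to neighbourhoods of [Some l] on the sphere; the image of the
    whole plane excludes infinite convergents from some index on. *)
Lemma cf_has_valueP (l : Cx R) :
  cf_has_value c (Some l) <->
  (\forall n \near \oo, cf_den n != 0) /\ cf_ratio n @[n --> \oo] --> l.
Proof.
split=> [cl | [den0 cl] U Ul]; last first.
  apply: filterS2 den0 (cl _ Ul) => n den0 Un.
  by rewrite /= cf_convergentE ifN.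
have cvgU U : nbhs l U -> \forall n \near \oo, (Some @` U) (cf_convergent c n).
  by move=> Ul; apply: cl; exact: one_point_compactification_some_nbhs.
split; last move=> U /cvgU.
  have : \forall n \near \oo, (Some @` setT) (cf_convergent c n).
    by apply: cvgU; exact: filterT.
  by apply: filterS => n [x _]; rewrite cf_convergentE; case: eqP.
by apply: filterS => n [x Ux] /=; rewrite cf_convergentE; case: eqP => // _ [<-].
Qed.

Hypothesis c_per : forall n, c n.+3 = c n.+1.

Lemma cf_periodic_step n :
  cf_num n.+3 = (c 0%N * c 1%N + 1) * cf_num n.+1 +
    (c 0%N * c 1%N * c 2%N + c 2%N - c 0%N ^+ 2 * c 1%N) * cf_den n.+1 /\
  cf_den n.+3 = c 1%N * cf_num n.+1 +
    (c 1%N * c 2%N + 1 - c 0%N * c 1%N) * cf_den n.+1.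
Proof.
exact: (periodic_continuant_step c_per cf_num0 cf_num1 cf_den0 cf_den1
  cf_numSS cf_denSS).
Qed.

Lemma cf_value_fixed (l : Cx R) : cf_has_value c (Some l) ->
  l * (c 1 * l + (c 1 * c 2 + 1 - c 0 * c 1)) =
  (c 0 * c 1 + 1) * l + (c 0 * c 1 * c 2 + c 2 - c 0 ^+ 2 * c 1).
Proof.
move=> /cf_has_valueP[den0 zl]; apply: moebius_limit_fixed zl _.
have d k : \forall n \near \oo, cf_den (n + k)%N != 0.
  exact: cvg_addnr k _ den0.
apply: filterS2 (d 1%N) (d 3%N) => n; rewrite addn1 addn3.
exact: moebius_ratio (cf_periodic_step n).1 (cf_periodic_step n).2.
Qed.

End FirstColumn.

(** * Irrationality of sqrt 2 and the integer solutions *)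

Lemma sqrt2_irrational (R : realType) (w z : int) :
  w%:~R = z%:~R * Num.sqrt (2 : R) -> w = 0 /\ z = 0.
Proof.
move=> wz; have z0 : z = 0.
  apply: (@sqr_eq_double_sqr w); apply: (@intr_inj R).
  by rewrite rmorphXn rmorphM rmorphXn /= wz exprMn sqr_sqrtr // mulrC.
by split=> //; apply: (@intr_inj R); rewrite wz z0 mul0r.
Qed.

Lemma normcR (R : realType) (x : R) : `|x%:C%C : Cx R| = `|x|%:C%C.
Proof. by rewrite normc_def /= expr0n addr0 sqrtr_sqr. Qed.

(** Both relations survive a common change of sign, so they cannot tell sqrt 2 from - sqrt 2: the
    sign [s] stays open here. *)
Lemma fixed_sqrt2_quotients (b a1 a2 : int) :
    2 * b * a1 = a1 * a2 -> a2 = a1 * (2 - b ^+ 2) ->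
  [\/ a1 = 0,
      exists2 s : int, s \in [:: 1; -1] & (b, a1, a2) = (s, s * 2, s * 2) |
      exists2 s : int, s \in [:: 1; -1] &
        (b, a1, a2) = (s * 2, - s * 2, s * 4)].
Proof.
move=> e1 e2; have [a10|a10] := eqVneq a1 0.
  by constructor 1.
have {e1} a2E : a2 = 2 * b by nia.
(* Squaring [a1 * (2 - b ^+ 2) = 2 * b] with [a1 * a1 >= 1] gives [(b * b - 2) ^+ 2 <= 4 * (b * b)],
   which already fails at [b * b = 9], as 49 > 36. *)
have bb : b * b < 9.
  have a11 : 1 <= a1 * a1 by nia.
  have e3 : (a1 * a1) * ((b * b - 2) * (b * b - 2)) = 4 * (b * b).
    have -> : 4 * (b * b) = a2 * a2 by rewrite a2E; ring.
    by rewrite e2; ring.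
  have le4 : (b * b - 2) * (b * b - 2) <= 4 * (b * b) by rewrite -e3; nia.
  by rewrite ltNge; apply/negP => b9; nia.
have : b \in [:: -2; -1; 0; 1; 2] by rewrite !inE; nia.
rewrite !inE => /or4P[/eqP bE|/eqP bE|/eqP bE|]; last case/orP=> /eqP bE; subst b.
- by constructor 3; exists (-1) => //; congr (_, _, _); lia.
- by constructor 2; exists (-1) => //; congr (_, _, _); lia.
(* [b = 0] would force [a1 = 0]. *)
- lia.
- by constructor 2; exists 1 => //; congr (_, _, _); lia.
- by constructor 3; exists 1 => //; congr (_, _, _); lia.
Qed.

(* With f x = (3 x + 4) / (2 x + 3), one has
   f x - sqrt 2 = (3 - 2 sqrt 2) (x - sqrt 2) / (2 x + 3). *)
Lemma moebius34_contract (R : realType) (x : R) : 0 <= x ->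
  `|(3 * x + 4) / (2 * x + 3) - Num.sqrt 2| <= 3^-1 * `|x - Num.sqrt 2|.
Proof.
move=> x0; set r := Num.sqrt 2.
have r2 : r ^+ 2 = 2 by rewrite sqr_sqrtr.
have r0 : 0 <= r by exact: sqrtr_ge0.
have -> : (3 * x + 4) / (2 * x + 3) - r = (3 - 2 * r) / (2 * x + 3) * (x - r).
  by field: r2; lra.
rewrite normrM ler_wpM2r // normf_div (ger0_norm (_ : 0 <= 2 * x + 3)); last lra.
rewrite ler_pdivrMr; last lra.
(* [|3 - 2 * r| <= 1] is enough, since [3^-1 * (2 * x + 3) >= 1]. *)
by rewrite ler_norml; apply/andP; split; nra.
Qed.

(** The scalar [t] cancels in the ratio, and conjugation by diag(s, 1) turns [[3, 4 s], [2 s, 3]]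
    into [[3, 4], [2, 3]]. *)
Lemma moebius34_ratio (K : fieldType) (s t x p q p' q' : K) :
    p' = t * (3 * p + 4 * s * q) -> q' = t * (2 * s * p + 3 * q) ->
    s ^+ 2 = 1 -> t != 0 -> q != 0 -> 2 * x + 3 != 0 -> p / q = s * x ->
  q' != 0 /\ p' / q' = s * ((3 * x + 4) / (2 * x + 3)).
Proof.
move=> p'E q'E s2 t0 q0 x0 pq.
have pE : p = s * x * q by rewrite -pq divfK.
have {}q'E : q' = t * q * (2 * x + 3) by rewrite q'E pE; ring: s2.
have {}p'E : p' = t * q * (s * (3 * x + 4)) by rewrite p'E pE; ring.
have q'0 : q' != 0 by rewrite q'E !mulf_neq0.
by split=> //; rewrite p'E q'E; field; rewrite t0 q0 x0.
Qed.

(** Each step advances the index by two, so up to the sign [s] the convergents are two interleaved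
    orbits of one contraction, started at [x0] and [3 / 2]. *)
Lemma cf_value_sqrt2 (R : realType) (c : nat -> Cx R) (s t x0 : R) :
    s ^+ 2 = 1 -> t != 0 ->
    (forall n, cf_num c n.+3 =
       t%:C%C * (3 * cf_num c n.+1 + 4 * s%:C%C * cf_den c n.+1) /\
     cf_den c n.+3 =
       t%:C%C * (2 * s%:C%C * cf_num c n.+1 + 3 * cf_den c n.+1)) ->
    cf_den c 1 != 0 -> cf_ratio c 1 = (s * x0)%:C%C -> 1 <= x0 <= 2 ->
    cf_den c 2 != 0 -> cf_ratio c 2 = (s * (3 / 2))%:C%C ->
  cf_has_value c (Some (s * Num.sqrt 2)%:C%C).
Proof.
move=> s2 t0 step den1 rat1 x0_12 den2 rat2; set r := Num.sqrt 2.
have r2 : r ^+ 2 = 2 by rewrite sqr_sqrtr.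
have r0 : 0 <= r by exact: sqrtr_ge0.
(* The bound 1 / (n + 1) replaces a geometric one: a factor 1/3 over two indices preserves it,
   because n + 3 <= 3 (n + 1). *)
pose P n := cf_den c n.+1 != 0 /\
  exists x : R, [/\ 0 <= x, `|x - r| <= n.+1%:R^-1 &
                   cf_ratio c n.+1 = (s * x)%:C%C].
have Pstep n : P n -> P n.+2.
  case=> den0 [x [x_ge0 xr ratE]].
  have x3 : (2 * x + 3)%:C%C != 0 :> Cx R.
    by rewrite -(rmorph0 (@real_complex R)) (inj_eq (@complexI R)); lra.
  have [den0' ratE'] : cf_den c n.+3 != 0 /\
      cf_ratio c n.+3 = (s * ((3 * x + 4) / (2 * x + 3)))%:C%C.
    rewrite !(rmorphM, fmorphV, rmorphD, rmorph_nat) /=.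
    apply: moebius34_ratio (step n).1 (step n).2 _ _ den0 _ _.
    - by rewrite -rmorphXn s2.
    - by rewrite -(rmorph0 (@real_complex R)) (inj_eq (@complexI R)).
    - by move: x3; rewrite rmorphD rmorphM !rmorph_nat.
    - by rewrite -[LHS]/(cf_ratio c n.+1) ratE rmorphM.
  split=> //; exists ((3 * x + 4) / (2 * x + 3)); split=> //.
    by apply: divr_ge0; lra.
  apply: le_trans (moebius34_contract x_ge0) _.
  apply: le_trans (ler_wpM2l _ xr) _; first lra.
  rewrite -invfM lef_pV2 ?posrE ?mulr_gt0 ?ltr0n //.
  by rewrite -natrM ler_nat mulnS -[n.+3]/(3 + n)%N leq_add2l leq_pmull.
have Pn n : P n.
  suff [] : P n /\ P n.+1 by [].
  elim: n => [|n [? ?]]; last by split=> //; exact: Pstep.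
  split; split=> //; [exists x0 | exists (3 / 2)]; split=> //.
  - by case/andP: x0_12; lra.
  - rewrite invr1 ler_norml; apply/andP; split; nra.
  - rewrite ler_norml; apply/andP; split; nra.
apply/cf_has_valueP; split.
  by exists 1%N => // -[//|n] _; exact: (Pn n).1.
(* In the order on complex numbers, [0 < e] makes [e] real. *)
apply/cvgrPdist_lt => e; rewrite ltcE /= => /andP[/eqP e_im e_gt0].
have eE : e = (complex.Re e)%:C%C by case: e e_im {e_gt0} => a b /= ->.
have [N _ Nn] := near_infty_natSinv_lt (PosNum e_gt0).
exists N.+1 => // -[//|n] /= Nn1; have [_ [x [_ xr ->]]] := Pn n.
rewrite eE -rmorphB normcR ltcR -mulrBr normrM.
have -> : `|s| = 1 by apply/eqP; rewrite -sqr_norm_eq1 s2.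
rewrite mul1r distrC; apply: le_lt_trans xr _; exact: Nn.
Qed.

Lemma cf_value_unique (R : realType) (c : nat -> Cx R) (l l' : Cx R) :
  cf_has_value c (Some l) -> cf_has_value c (Some l') -> l = l'.
Proof.
move=> /cf_has_valueP[_ cl] /cf_has_valueP[_ cl'].
exact: (cvg_unique (@norm_hausdorff _ (Cx R)) cl cl').
Qed.

(** * Integral expansions of type (1, 2) *)

Section Type12.
Variables (R : realType) (b a1 a2 : int).
Local Notation c := (@pcf_quotients R [:: b] [:: a1; a2]).

Lemma pcf12_periodic n : c n.+3 = c n.+1.
Proof. by rewrite /pcf_quotients /= !subn1 /= -addn2 modnDr. Qed.

Lemma pcf12_step n :
  cf_num c n.+3 = (b * a1 + 1)%:~R * cf_num c n.+1 +
    (b * a1 * a2 + a2 - b ^+ 2 * a1)%:~R * cf_den c n.+1 /\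
  cf_den c n.+3 = a1%:~R * cf_num c n.+1 +
    (a1 * a2 + 1 - b * a1)%:~R * cf_den c n.+1.
Proof.
have [-> ->] := cf_periodic_step pcf12_periodic n.
by rewrite !(rmorphB, rmorphD, rmorphXn, rmorphM).
Qed.

(* The hypotheses say that Q = t [[3, 4 s], [2 s, 3]], where [s] is the common
   sign that turns an expansion of sqrt 2 into one of - sqrt 2. *)
Lemma pcf12_value_sqrt2 (s t : int) :
    s ^+ 2 = 1 -> t ^+ 2 = 1 -> 1 <= s * b <= 2 ->
    b * a1 + 1 = 3 * t -> b * a1 * a2 + a2 - b ^+ 2 * a1 = 4 * s * t ->
    a1 = 2 * s * t -> a1 * a2 + 1 - b * a1 = 3 * t ->
  @Zpcf_for R [:: b] [:: a1; a2] (s%:~R * Num.sqrt 2)%:C%C.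
Proof.
move=> s2 t2 sb eA eB eC eE.
have sR2 : (s%:~R : R) ^+ 2 = 1 by rewrite -rmorphXn s2.
have s0 : (s%:~R : R) != 0 by rewrite intr_eq0; apply: contra_eq_neq s2 => ->.
have t0 : (t%:~R : R) != 0 by rewrite intr_eq0; apply: contra_eq_neq t2 => ->.
have a1E : c 1 = (2 * s%:~R * t%:~R)%:C%C.
  by rewrite /pcf_quotients /= eC !(rmorphM, rmorph_nat, rmorph_int).
have b0E : c 0 = b%:~R%:C%C by rewrite rmorph_int.
have num2 : cf_num c 2 = (3 * t%:~R)%:C%C.
  rewrite cf_numSS cf_num1 cf_num0 -[c 1]/(a1%:~R) -[c 0]/(b%:~R).
  by rewrite -intrM -[1]/(1%:~R) -intrD mulrC eA
    !(rmorphM, rmorph_nat, rmorph_int).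
have den2 : cf_den c 2 = (2 * s%:~R * t%:~R)%:C%C.
  by rewrite cf_denSS cf_den1 cf_den0 mulr1 addr0.
apply: (@cf_value_sqrt2 _ _ _ t%:~R (s * b)%:~R) => //.
- move=> n; have [-> ->] := pcf12_step n; rewrite eA eB eE eC.
  rewrite !(rmorphM, rmorph_nat, rmorph_int) /=.
  by split; rewrite mulrDr !mulrA; congr (_ * _ + _ * _); ring.
- by rewrite cf_den1 oner_eq0.
- rewrite /cf_ratio cf_den1 divr1 cf_num1 b0E -intrM mulrA -expr2 s2 mul1r //.
- by move: sb; rewrite -!(ler_int R).
- rewrite den2 -(rmorph0 (@real_complex R)) (inj_eq (@complexI R)).
  by rewrite !mulf_neq0 // pnatr_eq0.
- rewrite /cf_ratio num2 den2 -fmorphV -rmorphM; congr (_%:C%C).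
  by field: sR2; rewrite s0 t0.
Qed.

Lemma pcf12_sqrt2_relations :
    @Zpcf_for R [:: b] [:: a1; a2] (Num.sqrt 2)%:C%C ->
  2 * b * a1 = a1 * a2 /\ a2 = a1 * (2 - b ^+ 2).
Proof.
move=> /(cf_value_fixed pcf12_periodic).
rewrite -[c 0]/(b%:~R) -[c 1]/(a1%:~R) -[c 2]/(a2%:~R).
rewrite -!(rmorph_int (@real_complex R)) -(rmorph1 (@real_complex R)).
rewrite -!(rmorphXn, rmorphM, rmorphD, rmorphB) /= => /complexI.
rewrite !(rmorphXn, rmorphM, rmorphD, rmorphB) /=.
set r := Num.sqrt 2; have r2 : r ^+ 2 = 2 by rewrite sqr_sqrtr.
move=> fixE.
(* With [r ^+ 2 = 2] the fixed-point equation becomes w = z r for these two integers, so both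
   vanish. *)
have [|B0 A0] := @sqrt2_irrational R (2 * a1 - (b * a1 * a2 + a2 - b ^+ 2 * a1))
  (b * a1 + 1 - (a1 * a2 + 1 - b * a1)).
  rewrite !(rmorphXn, rmorphM, rmorphD, rmorphB) /=; rewrite -/r.
  have r2a : a1%:~R * r ^+ 2 = a1%:~R * 2 by rewrite r2.
  lra.
have a12 : 2 * b * a1 = a1 * a2 by lra.
by split=> //; rewrite -mulrA -a12 in B0; lra.
Qed.

Lemma pcf12_zero_diverges z : a1 = 0 ->
  ~ @Zpcf_for R [:: b] [:: a1; a2] z.
Proof.
move=> a10 /cf_has_valueP[[N _ den0] _].
have a1R : a1%:~R = 0 :> Cx R by rewrite a10.
(* For [a1 = 0] the matrix Q is upper triangular, so the zero [cf_den c 2 = a1] recurs every two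
   indices. *)
have den_even k : cf_den c k.*2.+2 = 0.
  elim: k => [|k IH].
    by rewrite cf_denSS cf_den0 -[c 1]/(a1%:~R) a1R mul0r addr0.
  by rewrite doubleS (pcf12_step _).2 IH a1R mul0r mulr0 addr0.
by have /eqP[] := den0 N.*2.+2 (ltac:(rewrite /=; lia)); exact: den_even.
Qed.

End Type12.

Theorem corollary8p10 (R : realType) (b1 a1 a2 : int) :
  Zpcf_for [:: b1] [:: a1; a2] ((Num.sqrt (2 : R))%:C)%C <->
  (b1, a1, a2) = (1, 2, 2) \/ (b1, a1, a2) = (2, - 2, 4).
Proof.
have value1 (s : int) : s \in [:: 1; -1] -> (b1, a1, a2) = (s, s * 2, s * 2) ->
    @Zpcf_for R [:: b1] [:: a1; a2] (s%:~R * Num.sqrt 2)%:C%C.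
  move=> s1 [-> -> ->]; move: s1; rewrite !inE => /orP[] /eqP->;
    by apply: (@pcf12_value_sqrt2 R _ _ _ _ 1); [lia..].
(* For equal [s], Q is the negative of the matrix in the first family, hence [t = -1] instead of
   1. *)
have value2 (s : int) : s \in [:: 1; -1] -> (b1, a1, a2) = (s * 2, - s * 2, s * 4) ->
    @Zpcf_for R [:: b1] [:: a1; a2] (s%:~R * Num.sqrt 2)%:C%C.
  move=> s1 [-> -> ->]; move: s1; rewrite !inE => /orP[] /eqP->;
    by apply: (@pcf12_value_sqrt2 R _ _ _ _ (-1)); [lia..].
split=> [val | quots]; last first.
  rewrite -[Num.sqrt 2]mul1r -[1]/(1%:~R).
  by case: quots => quots; [apply: value1 | apply: value2].
(* Uniqueness of the value settles the sign: [s = -1] would give sqrt 2 = - sqrt 2. *)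
have positive (s : int) : s \in [:: 1; -1] ->
    @Zpcf_for R [:: b1] [:: a1; a2] (s%:~R * Num.sqrt 2)%:C%C -> s = 1.
  rewrite !inE => /orP[] /eqP-> // /(cf_value_unique val) /complexI.
  have : 0 < Num.sqrt (2 : R) by rewrite sqrtr_gt0.
  by rewrite mulN1r => r0 rE; exfalso; lra.
have [rel1 rel2] := pcf12_sqrt2_relations val.
have [a10 | [s s1 E] | [s s1 E]] := fixed_sqrt2_quotients rel1 rel2.
- by case: (pcf12_zero_diverges a10 val).
- by left; rewrite E (positive s s1 (value1 s s1 E)).
- by right; rewrite E (positive s s1 (value2 s s1 E)).
Qed.
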